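(* Let $\mathbf A=(a_{ij})\in\mathbb H^{m\times n}$ have rank $r\ge 1$, and let $\mathbf A^{+}=(a^{+}_{ij})\in\mathbb H^{n\times m}$ be its Moore–Penrose inverse. Then for all $i=1,\dots,n$ and $j=1,\dots,m$, \[ a_{ij}^{+}=\frac{\sum_{\beta\in J_{r,n}\{i\}}\operatorname{cdet}_i\Big(\big((\mathbf A^{*}\mathbf A)_{.i}(\mathbf a^{*}_{.j})\big)^{\beta}_{\beta}\Big)}{\sum_{\beta\in J_{r,n}}\big|(\mathbf A^{*}\mathbf A)^{\beta}_{\beta}\big|} \] and also \[ a_{ij}^{+}=\frac{\sum_{\alpha\in I_{r,m}\{j\}}\operatorname{rdet}_j\Big(\big((\mathbf A\mathbf A^{*})_{j.}(\mathbf a^{*}_{i.})\big)^{\alpha}_{\alpha}\Big)}{\sum_{\alpha\in I_{r,m}}\big|(\mathbf A\mathbf A^{*})^{\alpha}_{\alpha}\big|}. \]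
   Context: $\mathbb H$ is the quaternion skew field; $\bar a$ is the quaternion conjugate and $\mathbf A^{*}=(\overline{a_{ji}})$ is the conjugate transpose. The rank of a quaternion matrix is the maximal number of right-linearly independent columns (equivalently, of left-linearly independent rows). The Moore–Penrose inverse of $\mathbf A\in\mathbb H^{m\times n}$ is the unique $\mathbf X\in\mathbb H^{n\times m}$ with $\mathbf A\mathbf X\mathbf A=\mathbf A$, $\mathbf X\mathbf A\mathbf X=\mathbf X$, $(\mathbf A\mathbf X)^*=\mathbf A\mathbf X$, $(\mathbf X\mathbf A)^*=\mathbf X\mathbf A$. Row and column determinants of $\mathbf M=(m_{ij})\in\mathbb H^{n\times n}$: for $i\in\{1,\dots,n\}$, $\operatorname{rdet}_i\mathbf M=\sum_{\sigma\in S_n}(-1)^{n-r}m_{i\,i_{k_1}}m_{i_{k_1}i_{k_1+1}}\cdots m_{i_{k_1+l_1}\,i}\cdots m_{i_{k_r}i_{k_r+1}}\cdots m_{i_{k_r+l_r}i_{k_r}}$, where $\sigma$ is written as a product of $r$ disjoint cycles (fixed points included) $\sigma=(i\,i_{k_1}\,i_{k_1+1}\dots i_{k_1+l_1})(i_{k_2}\dots i_{k_2+l_2})\cdots(i_{k_r}\dots i_{k_r+l_r})$, the first cycle starting with $i$, each other cycle starting with its smallest element, and $i_{k_2}<i_{k_3}<\dots<i_{k_r}$. For $j\in\{1,\dots,n\}$, $\operatorname{cdet}_j\mathbf M=\sum_{\tau\in S_n}(-1)^{n-r}m_{j_{k_r}j_{k_r+l_r}}\cdots m_{j_{k_r+1}j_{k_r}}\cdots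 m_{j\,j_{k_1+l_1}}\cdots m_{j_{k_1+1}j_{k_1}}m_{j_{k_1}j}$, where $\tau=(j_{k_r+l_r}\dots j_{k_r+1}j_{k_r})\cdots(j_{k_2+l_2}\dots j_{k_2+1}j_{k_2})(j_{k_1+l_1}\dots j_{k_1+1}j_{k_1}\,j)$ is written as a product of $r$ disjoint cycles, the rightmost cycle ending with $j$, each other cycle ending (on the right) with its smallest element, and $j_{k_2}<\dots<j_{k_r}$. For a Hermitian matrix ($\mathbf M^*=\mathbf M$) all $\operatorname{rdet}_i\mathbf M$ and $\operatorname{cdet}_j\mathbf M$ coincide and are real; their common value is denoted $\det\mathbf M$. Notation: $\mathbf a_{.j}$ is the $j$th column and $\mathbf a_{i.}$ the $i$th row of $\mathbf A$; $\mathbf a^{*}_{.j}$, $\mathbf a^{*}_{i.}$ are the $j$th column and $i$th row of $\mathbf A^{*}$. $\mathbf M_{.i}(\mathbf b)$ is $\mathbf M$ with its $i$th column replaced by the column $\mathbf b$; $\mathbf M_{j.}(\mathbf b)$ is $\mathbf M$ with its $j$th row replaced by the row $\mathbf b$. $L_{k,n}$ is the set of strictly increasing sequences $\beta=(\beta_1<\dots<\beta_k)$ from $\{1,\dots,n\}$; $J_{k,n}\{i\}=\{\beta\in L_{k,n}: i\in\beta\}$ and $I_{k,m}\{j\}=\{\alpha\in L_{k,m}:j\in\alpha\}$; $J_{k,n}=L_{k,n}$, $I_{k,m}=L_{k,m}$. For $\beta$, $\mathbf M^{\beta}_{\beta}$ is the principal submatrix with rows and columns indexed by $\beta$; for Hermitian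 $\mathbf M$, $|\mathbf M^{\beta}_{\beta}|=\det\mathbf M^{\beta}_{\beta}$ is a principal minor. In $\operatorname{cdet}_i(\mathbf N^{\beta}_{\beta})$ with $i\in\beta$, the subscript $i$ refers to the column of the submatrix coming from column $i$ of $\mathbf N$ (similarly for $\operatorname{rdet}_j$ and rows). *)

(* Defs.v *)
From HB Require Import structures.
From mathcomp Require Import all_boot all_order all_algebra all_fingroup.
From mathcomp Require Import reals.
From mathcomp Require Import ring.
Set Implicit Arguments.
Unset Strict Implicit.
Unset Printing Implicit Defensive.
Import Order.TTheory GRing.Theory Num.Theory.
Local Open Scope ring_scope.

(* Quaternions  a + b i + c j + d k  over a commutative ring R         *)
(* (the paper's H is quat R for R the real numbers).                   *)
Variant quat (R : Type) := Quat of R & R & R & R.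

Section QuatRing.
Variable R : comNzRingType.

Definition quat_to (q : quat R) : R * R * R * R :=
  let: Quat a b c d := q in (a, b, c, d).
Definition quat_of (p : R * R * R * R) : quat R :=
  let: (a, b, c, d) := p in Quat a b c d.
Lemma quat_toK : cancel quat_to quat_of. Proof. by case. Qed.

HB.instance Definition _ := Choice.copy (quat R) (can_type quat_toK).

Definition qzero : quat R := Quat 0 0 0 0.
Definition qopp (p : quat R) : quat R :=
  let: Quat a b c d := p in Quat (- a) (- b) (- c) (- d).
Definition qadd (p q : quat R) : quat R :=
  let: Quat a1 b1 c1 d1 := p in let: Quat a2 b2 c2 d2 := q in
  Quat (a1 + a2) (b1 + b2) (c1 + c2) (d1 + d2).

Lemma qaddA : associative qadd.
Proof. by case=> ????[????][????] /=; congr Quat; rewrite addrA. Qed.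
Lemma qaddC : commutative qadd.
Proof. by case=> ????[????] /=; congr Quat; rewrite addrC. Qed.
Lemma qadd0 : left_id qzero qadd.
Proof. by case=> ???? /=; congr Quat; rewrite add0r. Qed.
Lemma qaddN : left_inverse qzero qopp qadd.
Proof. by case=> ???? /=; congr Quat; rewrite addNr. Qed.

HB.instance Definition _ := GRing.isZmodule.Build (quat R) qaddA qaddC qadd0 qaddN.

Definition qone : quat R := Quat 1 0 0 0.
(* Hamilton product: i^2 = j^2 = k^2 = ijk = -1 *)
Definition qmul (p q : quat R) : quat R :=
  let: Quat a1 b1 c1 d1 := p in let: Quat a2 b2 c2 d2 := q in
  Quat (a1 * a2 - b1 * b2 - c1 * c2 - d1 * d2)
       (a1 * b2 + b1 * a2 + c1 * d2 - d1 * c2)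
       (a1 * c2 - b1 * d2 + c1 * a2 + d1 * b2)
       (a1 * d2 + b1 * c2 - c1 * b2 + d1 * a2).

Lemma qmulA : associative qmul.
Proof. by case=> ????[????][????] /=; congr Quat; ring. Qed.
Lemma qmul1 : left_id qone qmul.
Proof. by case=> ???? /=; congr Quat; ring. Qed.
Lemma qmulr1 : right_id qone qmul.
Proof. by case=> ???? /=; congr Quat; ring. Qed.
Lemma qmulDl : left_distributive qmul +%R.
Proof. by case=> ????[????][????] /=; congr Quat; ring. Qed.
Lemma qmulDr : right_distributive qmul +%R.
Proof. by case=> ????[????][????] /=; congr Quat; ring. Qed.
Lemma qone_neq0 : qone != 0.
Proof.
apply/eqP=> /(congr1 quat_to) /= [] /eqP; by rewrite oner_eq0.
Qed.

HB.instance Definition _ := GRing.Zmodule_isNzRing.Build (quat R)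
  qmulA qmul1 qmulr1 qmulDl qmulDr qone_neq0.

Definition qconj (q : quat R) : quat R :=
  let: Quat a b c d := q in Quat a (- b) (- c) (- d).

Definition qreal (x : R) : quat R := Quat x 0 0 0.

End QuatRing.

(* inverse of a quaternion: q^{-1} = \bar q / |q|^2 (and 0^{-1} = 0) *)
Definition qinv (R : fieldType) (q : quat R) : quat R :=
  let: Quat a b c d := q in
  qreal (a ^+ 2 + b ^+ 2 + c ^+ 2 + d ^+ 2)^-1 * qconj q.

Section QuatMatrices.
Variable R : comNzRingType.
Local Notation H := (quat R).

Definition qadj m n (A : 'M[H]_(m, n)) : 'M[H]_(n, m) :=
  \matrix_(i, j) qconj (A j i).

Definition is_MP_inverse m n (A : 'M[H]_(m, n)) (X : 'M[H]_(n, m)) : Prop :=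
  [/\ A *m X *m A = A, X *m A *m X = X,
      qadj (A *m X) = A *m X & qadj (X *m A) = X *m A].

Definition right_indep_cols m n (A : 'M[H]_(m, n)) (S : {set 'I_n}) : Prop :=
  forall c : 'I_n -> H,
    (forall i : 'I_m, \sum_(k in S) A i k * c k = 0) ->
    forall k, k \in S -> c k = 0.

Definition qrank_is m n (A : 'M[H]_(m, n)) (r : nat) : Prop :=
  (exists S : {set 'I_n}, #|S| = r /\ right_indep_cols A S) /\
  (forall S : {set 'I_n}, right_indep_cols A S -> (#|S| <= r)%N).

Definition cycprod n (M : 'M[H]_n) (s : 'S_n) (c : 'I_n) : H :=
  \prod_(t < #|porbit s c|) M ((s ^+ t)%g c) ((s ^+ t.+1)%g c).

Definition cyc_leader n (s : 'S_n) (c : 'I_n) : bool :=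
  [forall d in porbit s c, (c <= d)%N].

(* rdet_i M: cycle of i first (starting at i), then the other cycles,
   each starting with its smallest element, in increasing order of
   these smallest elements; sign (-1)^(n - #cycles). *)
Definition rdet n (M : 'M[H]_n) (i : 'I_n) : H :=
  \sum_(s : 'S_n) (-1) ^+ (n - #|porbits s|) *
    (cycprod M s i *
     \prod_(c < n | cyc_leader s c && (c \notin porbit s i)) cycprod M s c).

(* cdet_j M: the other cycles (each ending on the right with its
   smallest element) in decreasing order of their smallest elements,
   then the cycle of j (ending on the right with j). Written out, a
   cycle (a_l ... a_1 a_0) contributes m_{a_0 a_l} m_{a_l a_(l-1)} ...
   m_{a_1 a_0}, which is exactly cycprod M s a_0. *)
Definition cdet n (M : 'M[H]_n) (j : 'I_n) : H :=
  \sum_(s : 'S_n) (-1) ^+ (n - #|porbits s|) *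
    ((\prod_(c <- rev (enum 'I_n) | cyc_leader s c && (c \notin porbit s j))
        cycprod M s c) * cycprod M s j).

(* determinant of a Hermitian matrix: the common value of all rdet_i
   and cdet_j; here taken as rdet_1 (the empty matrix has det 1). *)
Definition hdet n : 'M[H]_n -> H :=
  match n with
  | 0 => fun _ => 1
  | n'.+1 => fun M => rdet M ord0
  end.

Definition colrep m n (M : 'M[H]_(m, n)) (i : 'I_n) (b : 'cV[H]_m) :=
  \matrix_(k, l) if l == i then b k 0 else M k l.
Definition rowrep m n (M : 'M[H]_(m, n)) (j : 'I_m) (b : 'rV[H]_n) :=
  \matrix_(k, l) if k == j then b 0 l else M k l.

Definition incr_seq r n (b : {ffun 'I_r -> 'I_n}) : bool :=
  [forall a : 'I_r, forall c : 'I_r, (a < c)%N ==> (b a < b c)%N].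

Definition psubmx r n (M : 'M[H]_n) (b : {ffun 'I_r -> 'I_n}) : 'M[H]_r :=
  mxsub b b M.

End QuatMatrices.

(* Main.v *)
Require Import Defs.
From HB Require Import structures.
From mathcomp Require Import all_boot all_order all_algebra all_fingroup.
From mathcomp Require Import reals.
From mathcomp Require Import ring lra zify.
Set Implicit Arguments.
Unset Strict Implicit.
Unset Printing Implicit Defensive.
Import Order.TTheory GRing.Theory Num.Theory.
Local Open Scope ring_scope.

(** Let G = A* A. Averaging a permutation with the ones obtained by inverting
    its cycles replaces, in the determinants at hand, the product along each
    cycle by its real part, so that the order of the cycles and their starting
    points no longer matter. Splitting and merging cycles with a transposition
    is then a sign-reversing involution; it gives Cramer's rule on every
    principal submatrix and, for the matrix N_k of the sums over |beta| = k of
    the cofactors and the sum d_k of the principal minors of order k, the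
    recursion N_(k+1) = d_k I - N_k G, with k d_k = Re tr (N_k G).

    For |beta| = r + 1 the minor vanishes, hence so does the positive expression
    x G x* for each cofactor row x, and therefore x A*; this gives
    N_(r+1) A* = 0, that is d_r A* = N_r G A*, whence d_r A+ = N_r A*. The same
    expression x G x* shows inductively that the Gram minors of independent
    columns are positive, so d_r > 0. The row version follows because the
    recursion makes N_k A* = A* N'_k and d_k = d'_k for the quantities attached
    to A A*, and because rdet_i M* is the conjugate of cdet_i M. *)

(** * Quaternions *)

Section QuaternionAlgebra.
Variable R : comNzRingType.
Implicit Types (p q : quat R) (x y : R).

Definition qre q : R := let: Quat a _ _ _ := q in a.

Lemma qre_is_zmod_morphism : zmod_morphism qre.
Proof. by case=> ????[????]. Qed.
HB.instance Definition _ :=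
  GRing.isZmodMorphism.Build (quat R) R qre qre_is_zmod_morphism.

(** The real part is a trace functional. This is what frees the real part of a cycle product from
    its starting point. *)
Lemma qreMC p q : qre (p * q) = qre (q * p).
Proof. by case: p => ????; case: q => ???? /=; ring. Qed.

Lemma qreal_is_zmod_morphism : zmod_morphism (@qreal R).
Proof.
by move=> x y; rewrite /qreal; congr Quat => /=; rewrite oppr0 addr0.
Qed.
HB.instance Definition _ :=
  GRing.isZmodMorphism.Build R (quat R) (@qreal R) qreal_is_zmod_morphism.

Lemma qreal_is_monoid_morphism : monoid_morphism (@qreal R).
Proof. by split=> // x y; rewrite /qreal; congr Quat => /=; ring. Qed.
HB.instance Definition _ :=
  GRing.isMonoidMorphism.Build R (quat R) (@qreal R) qreal_is_monoid_morphism.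

Lemma qrealK : cancel (@qreal R) qre. Proof. by []. Qed.

Lemma qrealC x q : qreal x * q = q * qreal x.
Proof. by case: q => ????; congr Quat => /=; ring. Qed.

Lemma qconj_is_zmod_morphism : zmod_morphism (@qconj R).
Proof. by case=> ????[????]; congr Quat => /=; ring. Qed.
HB.instance Definition _ :=
  GRing.isZmodMorphism.Build (quat R) (quat R) (@qconj R)
    qconj_is_zmod_morphism.

Lemma qconjK : involutive (@qconj R).
Proof. by case=> ????; rewrite /qconj !opprK. Qed.

Lemma qconjM p q : qconj (p * q) = qconj q * qconj p.
Proof. by case: p => ????; case: q => ????; congr Quat => /=; ring. Qed.

Lemma qconj_real x : qconj (qreal x) = qreal x.
Proof. by rewrite /qreal /= !oppr0. Qed.

Lemma qconj1 : qconj (1 : quat R) = 1.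
Proof. exact: (qconj_real 1). Qed.

Lemma addr_qconj q : q + qconj q = qreal (qre q *+ 2).
Proof. by case: q => ????; congr Quat => /=; rewrite ?subrr // mulr2n. Qed.

Lemma qconj_prod (I : Type) (s : seq I) (P : pred I) (F : I -> quat R) :
  qconj (\prod_(i <- s | P i) F i) = \prod_(i <- rev s | P i) qconj (F i).
Proof.
elim: s => [|x s IHs]; first by rewrite !big_nil qconj1.
rewrite big_cons rev_cons -cats1 big_cat big_cons big_nil /=.
by case: (P x); rewrite ?mulr1 // qconjM IHs.
Qed.

Lemma qreal_sign k : (-1) ^+ k = qreal ((-1) ^+ k) :> quat R.
Proof. by rewrite rmorphXn rmorphN rmorph1. Qed.

Lemma qconj_sign k : qconj ((-1) ^+ k : quat R) = (-1) ^+ k.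
Proof. by rewrite qreal_sign qconj_real. Qed.

End QuaternionAlgebra.

(** * Conjugate transposes and the real trace *)

Section QuaternionMatrix.
Variable R : comNzRingType.
Local Notation H := (quat R).

Lemma qadjE m n (A : 'M[H]_(m, n)) i j : qadj A i j = qconj (A j i).
Proof. by rewrite mxE. Qed.

Definition qherm n (M : 'M[H]_n) := qadj M = M.

Lemma qhermE n (M : 'M[H]_n) i j : qherm M -> qconj (M i j) = M j i.
Proof. by move=> {2}<-; rewrite mxE. Qed.

Lemma qadjK m n (A : 'M[H]_(m, n)) : qadj (qadj A) = A.
Proof. by apply/matrixP=> i j; rewrite !mxE qconjK. Qed.

Lemma qadjM m n p (A : 'M[H]_(m, n)) (B : 'M[H]_(n, p)) :
  qadj (A *m B) = qadj B *m qadj A.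
Proof.
apply/matrixP=> i j; rewrite !mxE raddf_sum /=; apply: eq_bigr => k _.
by rewrite !mxE qconjM.
Qed.

Lemma qadjB m n (A B : 'M[H]_(m, n)) : qadj (A - B) = qadj A - qadj B.
Proof. by apply/matrixP=> i j; rewrite !mxE raddfB. Qed.

Lemma qadj_scalar n x : qadj (qreal x)%:M = (qreal x)%:M :> 'M[H]_n.
Proof.
apply/matrixP=> i j; rewrite !mxE eq_sym.
by case: eqP => _; rewrite ?mulr1n ?mulr0n ?qconj_real // (raddf0 (@qconj R)).
Qed.

Lemma scalar_mx_realC m n x (A : 'M[H]_(m, n)) :
  (qreal x)%:M *m A = A *m (qreal x)%:M.
Proof.
apply/matrixP=> i j; rewrite !mxE (bigD1 i) //= (bigD1 j) //= !mxE !eqxx.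
rewrite !big1 ?addr0 1?qrealC // => k ne_k; rewrite !mxE.
  by rewrite (negbTE ne_k) mulr0.
by rewrite eq_sym (negbTE ne_k) mul0r.
Qed.

Lemma qre_trmxC m n (A : 'M[H]_(m, n)) (B : 'M[H]_(n, m)) :
  qre (\tr (A *m B)) = qre (\tr (B *m A)).
Proof.
rewrite !raddf_sum /=.
under eq_bigr do rewrite mxE raddf_sum.
under [RHS]eq_bigr do rewrite mxE raddf_sum.
rewrite exchange_big; apply: eq_bigr => i _; apply: eq_bigr => j _.
exact: qreMC.
Qed.

End QuaternionMatrix.

(** * The norm form and its positivity *)

Section QuaternionNorm.
Variable R : realFieldType.
Local Notation H := (quat R).

Lemma qre_mul_conj_ge0 (q : H) : 0 <= qre (q * qconj q).
Proof. by case: q => a b c d /=; nra. Qed.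

Lemma qre_mul_conj_eq0 (q : H) : qre (q * qconj q) = 0 -> q = 0.
Proof.
case: q => a b c d /= h.
by congr Quat; apply/eqP; rewrite -sqrf_eq0; apply/eqP; nra.
Qed.

Lemma qinv_real (x : R) : qinv (qreal x) = qreal x^-1.
Proof.
rewrite /qinv /qreal /= expr0n /= !addr0.
have [->|x0] := eqVneq x 0.
  by congr Quat; rewrite ?expr0n ?invr0 /=; ring.
by congr Quat; field.
Qed.

Lemma mulmx_qadj_qre m n (A : 'M[H]_(m, n)) i :
  qre ((A *m qadj A) i i) = \sum_j qre (A i j * qconj (A i j)).
Proof. by rewrite mxE raddf_sum; apply: eq_bigr => j _; rewrite mxE. Qed.

Lemma mulmx_qadj_qre_ge0 m n (A : 'M[H]_(m, n)) i :
  0 <= qre ((A *m qadj A) i i).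
Proof.
by rewrite mulmx_qadj_qre sumr_ge0 // => j _; apply: qre_mul_conj_ge0.
Qed.

Lemma mulmx_qadj_qre_eq0 m n (A : 'M[H]_(m, n)) i :
  qre ((A *m qadj A) i i) = 0 -> row i A = 0.
Proof.
rewrite mulmx_qadj_qre => /psumr_eq0P h; apply/rowP=> j; rewrite !mxE.
by apply/qre_mul_conj_eq0/h => // k _; apply: qre_mul_conj_ge0.
Qed.

End QuaternionNorm.

(** * Cycles of permutations *)

Section PermOrbits.
Variable T : finType.
Implicit Types (s t : {perm T}) (x y c : T).

Lemma permXS s k x : (s ^+ k.+1)%g x = s ((s ^+ k)%g x).
Proof. by rewrite expgSr permM. Qed.

Lemma card_porbit_gt0 s x : (0 < #|porbit s x|)%N.
Proof. by rewrite lt0n card_porbit_neq0. Qed.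

Lemma permX_card_porbit s x : (s ^+ #|porbit s x|)%g x = x.
Proof. by rewrite permX iter_porbit. Qed.

Lemma permX_porbit_neq s x k :
  (0 < k < #|porbit s x|)%N -> (s ^+ k)%g x != x.
Proof.
case/andP=> k0 kp; have := uniq_traject_porbit s x.
move/uniqP => /(_ x k 0%N); rewrite !inE size_traject.
move/(_ kp (card_porbit_gt0 s x)).
rewrite !nth_traject ?card_porbit_gt0 // -permX /= => h.
by apply/eqP=> /h k_0; rewrite k_0 in k0.
Qed.

Lemma porbit1 s x : porbit s (s x) = porbit s x.
Proof. exact: (porbit_perm s 1). Qed.

Lemma porbit_sub s x y : x \in porbit s y -> porbit s x = porbit s y.
Proof. by rewrite -eq_porbit_mem => /eqP. Qed.

Lemma mem_porbit1 s x c : (s x \in porbit s c) = (x \in porbit s c).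
Proof. by rewrite -!eq_porbit_mem porbit1. Qed.

Lemma mem_porbitV1 s x c : ((s^-1)%g x \in porbit s c) = (x \in porbit s c).
Proof. by rewrite -porbitV mem_porbit1. Qed.

Lemma permV_porbitE s x : (s^-1)%g x = (s ^+ #|porbit s x|.-1)%g x.
Proof.
apply: (@perm_inj _ s); rewrite permKV -permXS prednK ?card_porbit_gt0 //.
by rewrite permX_card_porbit.
Qed.

Lemma eq_on_porbitX s s' x :
  (forall y, y \in porbit s x -> s' y = s y) ->
  forall k, (s' ^+ k)%g x = (s ^+ k)%g x.
Proof.
by move=> h; elim=> [|k IH]; rewrite ?expg0 // !permXS IH h // mem_porbit.
Qed.

Lemma eq_on_porbit s s' x :
  (forall y, y \in porbit s x -> s' y = s y) -> porbit s' x = porbit s x.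
Proof.
move=> h; apply/setP=> y; apply/porbitP/porbitP=> -[k ->]; exists k;
by rewrite (eq_on_porbitX h).
Qed.

(** Reversing a single cycle keeps all orbits, hence the sign and the leaders of the cycles. *)
Definition flip_fun s c x := if x \in porbit s c then (s^-1)%g x else s x.

Lemma flip_fun_inj s c : injective (flip_fun s c).
Proof.
move=> x y; rewrite /flip_fun.
case: ifPn => xc; case: ifPn => yc; try exact: perm_inj.
  by move=> e; case/negP: yc; rewrite -mem_porbit1 -e mem_porbitV1.
by move=> e; case/negP: xc; rewrite -mem_porbit1 e mem_porbitV1.
Qed.

Definition flip s c : {perm T} := perm (@flip_fun_inj s c).

Lemma flipE s c x : flip s c x = if x \in porbit s c then (s^-1)%g x else s x.
Proof. by rewrite permE. Qed.

Lemma porbit_flip s c x : porbit (flip s c) x = porbit s x.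
Proof.
case: (boolP (x \in porbit s c)) => xc.
  rewrite -(porbitV s); apply: eq_on_porbit => y.
  by rewrite porbitV flipE (porbit_sub xc) => ->.
apply: eq_on_porbit => y yx; rewrite flipE ifN //; apply: contra xc => yc.
by rewrite -(porbit_sub yc) porbit_sym.
Qed.

Lemma flipK c : involutive (flip^~ c).
Proof.
move=> s; apply/permP=> x; rewrite flipE porbit_flip.
case: (boolP (x \in porbit s c)) => xc; last by rewrite flipE (negbTE xc).
by apply: (@perm_inj _ (flip s c)); rewrite permKV flipE mem_porbit1 xc permK.
Qed.

Lemma odd_flip s c : odd_perm (flip s c) = odd_perm s.
Proof.
rewrite /odd_perm; congr (_ (+) odd #|pred_of_set _|); apply: eq_imset => x.
exact: porbit_flip.
Qed.

Lemma perm_on_flip (B : {set T}) s c : perm_on B s -> perm_on B (flip s c).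
Proof.
move=> sB; apply/subsetP=> x; rewrite inE /= flipE; apply: contraR => xB.
by case: ifP => _; rewrite ?(out_perm (perm_onV sB)) ?(out_perm sB).
Qed.

Section Merge.
Variables (t : {perm T}) (i l : T).
Hypothesis il : l \notin porbit t i.
Let s := (t * tperm i l)%g.

Let sE y : s y = tperm i l (t y). Proof. by rewrite permM. Qed.

Let i_neq_l : i != l.
Proof. by apply: contraNneq il => <-; exact: porbit_id. Qed.

Let li : i \notin porbit t l. Proof. by rewrite porbit_sym. Qed.

(** Where [t] would return to [i], [s] jumps to [l], and where [t] would return to [l], it jumps to
    [i]. So the cycle of [s] from [i] runs through the [t]-cycle of [i] and then through that of
    [l]. *)
Lemma permX_merge_fst k :
  (k < #|porbit t i|)%N -> (s ^+ k)%g i = (t ^+ k)%g i.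
Proof.
elim: k => [|k IH] hk; rewrite ?expg0 // !permXS IH; last exact: ltnW.
rewrite sE tpermD // eq_sym -permXS ?permX_porbit_neq //.
by apply: contraNneq il => <-; exact: mem_porbit.
Qed.

Lemma permX_merge_mid : (s ^+ #|porbit t i|)%g i = l.
Proof.
rewrite -(prednK (card_porbit_gt0 t i)) permXS permX_merge_fst; last first.
  by rewrite prednK ?card_porbit_gt0.
by rewrite -permV_porbitE sE permKV tpermL.
Qed.

Lemma permX_merge_snd k :
  (k < #|porbit t l|)%N -> (s ^+ (#|porbit t i| + k))%g i = (t ^+ k)%g l.
Proof.
elim: k => [|k IH] hk; first by rewrite addn0 permX_merge_mid expg0 perm1.
rewrite addnS !permXS IH; last exact: ltnW.
rewrite sE tpermD // eq_sym -permXS ?permX_porbit_neq //.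
by apply: contraNneq li => <-; exact: mem_porbit.
Qed.

Lemma permX_merge_end : (s ^+ (#|porbit t i| + #|porbit t l|))%g i = i.
Proof.
rewrite -(prednK (card_porbit_gt0 t l)) addnS permXS permX_merge_snd.
  by rewrite -permV_porbitE sE permKV tpermR.
by rewrite prednK ?card_porbit_gt0.
Qed.

Lemma porbit_merge : porbit s i = porbit t i :|: porbit t l.
Proof.
apply/eqP; rewrite eqEsubset; apply/andP; split; apply/subsetP=> y; last first.
  case/setUP; rewrite porbit_traject => /trajectP[k hk ->]; rewrite -permX.
    by rewrite -permX_merge_fst ?mem_porbit.
  by rewrite -permX_merge_snd ?mem_porbit.
case/porbitP=> k ->; elim: k => [|k IH].
  by rewrite expg0 perm1 inE porbit_id.
rewrite permXS sE; case: tpermP => [_|_|_ _]; rewrite ?inE ?porbit_id ?orbT //.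
by rewrite !mem_porbit1 -in_setU.
Qed.

Lemma card_porbit_merge : #|porbit s i| = (#|porbit t i| + #|porbit t l|)%N.
Proof.
rewrite porbit_merge cardsU; suff -> : porbit t i :&: porbit t l = set0.
  by rewrite cards0 subn0.
apply/setP=> y; rewrite !inE; apply/negP=> /andP[yi yl].
by case/negP: il; rewrite -(porbit_sub yi) porbit_sym.
Qed.

Lemma merge_out y : y \notin porbit s i -> s y = t y.
Proof.
rewrite porbit_merge inE negb_or => /andP[yi yl].
rewrite sE tpermD //.
  by apply: contraNneq yi => e; rewrite -mem_porbit1 -e porbit_id.
by apply: contraNneq yl => e; rewrite -mem_porbit1 -e porbit_id.
Qed.

End Merge.

(** A transposition changes the number of cycles by one, up or down according to the membership.
    Counting from [t] to [s] and back, on the inverses because the transposition must stand on the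
    left, leaves exactly one of the two memberships true. *)
Lemma porbit_mul_tperm t i l : i != l ->
  (l \in porbit (t * tperm i l)%g i) = (l \notin porbit t i).
Proof.
move=> il; set s := (t * tperm i l)%g.
have e1 := porbits_mul_tperm (t^-1)%g i l.
have e2 := porbits_mul_tperm (s^-1)%g i l.
have sV : (s^-1 = tperm i l * t^-1)%g by rewrite invMg tpermV.
rewrite /= in e1 e2; rewrite [in X in (#|porbits X| + _)%N]sV tpermKg in e2.
rewrite -sV il !porbitV !porbitsV in e1 e2.
rewrite ![_ \in porbit _ i]porbit_sym.
by move: e1 e2; case: (i \in porbit t l); case: (i \in porbit s l) => /=; lia.
Qed.

End PermOrbits.

(** * Products of matrix entries along cycles *)

Section CycleProducts.
Variables (R : comNzRingType) (n : nat).
Local Notation H := (quat R).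
Implicit Types (M N : 'M[H]_n) (s t : 'S_n) (i c x : 'I_n) (D : {set 'I_n}).

Lemma cycprodE M s c :
  cycprod M s c =
  \prod_(0 <= k < #|porbit s c|) M ((s ^+ k)%g c) ((s ^+ k.+1)%g c).
Proof. by rewrite big_mkord. Qed.

(** The omitted last factor of the cycle product is its only entry from column [c], so this product
    is blind to a replacement of that column. *)
Definition pathprod M s c : H :=
  \prod_(0 <= k < #|porbit s c|.-1) M ((s ^+ k)%g c) ((s ^+ k.+1)%g c).

Lemma cycprod_last M s c : cycprod M s c = pathprod M s c * M ((s^-1)%g c) c.
Proof.
rewrite cycprodE -(prednK (card_porbit_gt0 s c)) big_nat_recr //=.
congr (_ * M _ _); first by rewrite permV_porbitE.
by rewrite prednK ?card_porbit_gt0 // permX_card_porbit.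
Qed.

Lemma eq_pathprod M N s s' c :
  (forall y, y \in porbit s c -> s' y = s y) ->
  (forall y, y \in porbit s c -> s y != c -> N y (s y) = M y (s y)) ->
  pathprod N s' c = pathprod M s c.
Proof.
move=> hs hM; rewrite /pathprod (eq_on_porbit hs); apply: eq_big_nat => k /= hk.
rewrite !(eq_on_porbitX hs) permXS hM ?mem_porbit //.
by rewrite -permXS permX_porbit_neq //=; case: #|_| hk.
Qed.

Lemma eq_cycprod M N s s' c :
  (forall y, y \in porbit s c -> s' y = s y) ->
  (forall y, y \in porbit s c -> N y (s y) = M y (s y)) ->
  cycprod N s' c = cycprod M s c.
Proof.
move=> hs hM; rewrite !cycprodE (eq_on_porbit hs); apply: eq_big_nat => k /= hk.
by rewrite !(eq_on_porbitX hs) permXS hM ?mem_porbit.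
Qed.

(** Merging exchanges the columns of the two closing factors and nothing else. If columns [i] and
    [l] of [M] agree, the result is the product of the two cycle products. *)
Lemma cycprod_merge M t i l : l \notin porbit t i ->
  cycprod M (t * tperm i l)%g i =
  pathprod M t i * M ((t^-1)%g i) l * (pathprod M t l * M ((t^-1)%g l) i).
Proof.
move=> il; set s := (t * tperm i l)%g.
rewrite cycprodE card_porbit_merge //.
rewrite (big_cat_nat _ (n := #|porbit t i|)) ?leq_addr //=.
congr (_ * _).
  have p0 := card_porbit_gt0 t i.
  rewrite -{1}(prednK p0) big_nat_recr //=; congr (_ * M _ _).
  - apply: eq_big_nat => k /andP[_ hk].
    by rewrite !permX_merge_fst //; case: #|_| hk p0 => //= p; lia.
  - by rewrite permX_merge_fst ?permV_porbitE // prednK.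
  - by rewrite prednK // permX_merge_mid.
have q0 := card_porbit_gt0 t l.
rewrite -[X in \prod_(X <= _ < _) _]add0n big_addn addKn.
rewrite -{1}(prednK q0) big_nat_recr //=; congr (_ * M _ _).
- apply: eq_big_nat => k /andP[_ hk].
  rewrite [(k + _)%N]addnC -addnS !permX_merge_snd //;
  by case: #|_| hk q0 => //= p; lia.
- by rewrite addnC permX_merge_snd ?permV_porbitE // prednK.
- by rewrite -addSn prednK // addnC permX_merge_end.
Qed.

Lemma qconj_prod_nat p (F : nat -> H) :
  qconj (\prod_(0 <= k < p) F k) = \prod_(0 <= k < p) qconj (F (p - k.+1)%N).
Proof.
elim: p => [|p IH]; first by rewrite !big_nil qconj1.
by rewrite big_nat_recr //= qconjM IH [in RHS]big_nat_recl //= subn1.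
Qed.

(** Conjugation reverses the order of the factors, which matches walking the cycle backwards. *)
Lemma cycprod_adj M s c : cycprod (qadj M) (s^-1)%g c = qconj (cycprod M s c).
Proof.
rewrite !cycprodE porbitV qconj_prod_nat; apply: eq_big_nat => k /andP[_ hk].
have sV j : (j <= #|porbit s c|)%N ->
    ((s^-1) ^+ j)%g c = (s ^+ (#|porbit s c| - j))%g c.
  move=> hj; rewrite expgVn; apply: (@perm_inj _ (s ^+ j)%g).
  by rewrite permKV -permM -expgD subnK // permX_card_porbit.
by rewrite (sV k (ltnW hk)) (sV _ hk) mxE subnSK.
Qed.

Lemma cycprod_flip M s c :
  (forall x y, x \in porbit s c -> y \in porbit s c -> qconj (M x y) = M y x) ->
  cycprod M (flip s c) c = qconj (cycprod M s c).
Proof.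
move=> hM; rewrite -cycprod_adj; apply: eq_cycprod => y; rewrite porbitV => yc.
  by rewrite flipE yc.
by rewrite !mxE hM // mem_porbitV1.
Qed.

Lemma cycprod_flip_out M s c x :
  x \notin porbit s c -> cycprod M (flip s c) x = cycprod M s x.
Proof.
move=> xc; apply: eq_cycprod => // y yx; rewrite flipE ifN //.
by apply: contra xc => yc; rewrite -(porbit_sub yc) porbit_sym.
Qed.

Lemma qre_cycprod1 M s c : qre (cycprod M s (s c)) = qre (cycprod M s c).
Proof.
rewrite !cycprodE porbit1; have p0 := card_porbit_gt0 s c.
have e := permX_card_porbit s c.
have sX k : (s ^+ k)%g (s c) = (s ^+ k.+1)%g c by rewrite expgS permM.
under eq_bigr do rewrite !sX.
rewrite -(prednK p0) in e *.
rewrite big_nat_recr //= [in RHS]big_nat_recl //= qreMC expg0 perm1 e.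
by rewrite [(s ^+ _.+2)%g _]permXS e expg1.
Qed.

Lemma qre_cycprod M s c x :
  x \in porbit s c -> qre (cycprod M s x) = qre (cycprod M s c).
Proof.
case/porbitP=> k ->; elim: k => [|k IH]; first by rewrite expg0 perm1.
by rewrite permXS qre_cycprod1.
Qed.

Lemma eq_cyc_leader s s' c :
  porbit s c = porbit s' c -> cyc_leader s c = cyc_leader s' c.
Proof. by rewrite /cyc_leader => ->. Qed.

Lemma cyc_leader_exists s c : exists2 l, l \in porbit s c & cyc_leader s l.
Proof.
have [l lc lmin] := arg_minnP (fun x : 'I_n => x : nat) (porbit_id s c).
by exists l => //; apply/forall_inP=> d; rewrite (porbit_sub lc); apply: lmin.
Qed.

Lemma cyc_leader_uniq s x y :
  cyc_leader s x -> cyc_leader s y -> x \in porbit s y -> x = y.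
Proof.
move=> /forall_inP hx /forall_inP hy xy; apply/val_inj/eqP; rewrite eqn_leq.
by rewrite hx ?hy // porbit_sym.
Qed.

(** The factors are real and commute, and by [qre_cycprod] a leader merely selects one point of each
    cycle. *)
Definition cycweight M s D : R :=
  \prod_(x in D | cyc_leader s x) qre (cycprod M s x).

Lemma cycweight_split M s D c : porbit s c \subset D ->
  cycweight M s D = qre (cycprod M s c) * cycweight M s (D :\: porbit s c).
Proof.
move=> /subsetP cD; have [l lc lL] := cyc_leader_exists s c.
rewrite /cycweight (bigD1 l) ?cD //=; congr (_ * _); first exact: qre_cycprod.
apply: eq_bigl => x; rewrite inE.
case xL: (cyc_leader s x); rewrite ?andbF ?andbT //= andbC; congr (_ && _).
congr (~~ _); apply/eqP/idP=> [-> //|xc].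
by apply: (cyc_leader_uniq xL lL); rewrite (porbit_sub lc).
Qed.

Lemma eq_cycweight M N s s' D :
  (forall x y, x \in D -> y \in porbit s x -> s' y = s y) ->
  (forall x y, x \in D -> y \in porbit s x -> N y (s y) = M y (s y)) ->
  cycweight N s' D = cycweight M s D.
Proof.
move=> hs hM; apply: eq_big => [x|x /andP[xD _]].
  case: (boolP (x \in D)) => //= xD; apply: eq_cyc_leader.
  by apply: eq_on_porbit => y; apply: hs.
by congr qre; apply: eq_cycprod => y; [apply: hs | apply: hM].
Qed.

Lemma cycweight_flip M s D c : [disjoint D & porbit s c] ->
  cycweight M (flip s c) D = cycweight M s D.
Proof.
move=> dD; apply: eq_cycweight => // x y xD yx; rewrite flipE ifN //.
apply: contraL xD => yc; apply/negP=> xD; move/pred0P: dD => /(_ x) /=.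
by rewrite xD /= porbit_sym -(porbit_sub yx) porbit_sym yc.
Qed.

End CycleProducts.

Section Flip.
Variables (R : realFieldType) (n : nat).
Local Notation H := (quat R).
Implicit Types (M N : 'M[H]_n) (s t : 'S_n) (i c x : 'I_n) (D : {set 'I_n}).

Lemma quat_addrr_inj : injective (fun q : H => q + q).
Proof. by move=> [????] [????] [????]; congr Quat; lra. Qed.

(* Averaging over a cycle and its inverse replaces the cycle product by its
   real part, since the two products are conjugate. *)
Lemma sum_flip (P : pred 'S_n) (F K : 'S_n -> H) M c :
  (forall s, P s -> P (flip s c)) ->
  (forall s, P s -> F (flip s c) = F s) ->
  (forall s, P s -> K (flip s c) = K s) ->
  (forall s x y, P s -> x \in porbit s c -> y \in porbit s c ->
     qconj (M x y) = M y x) ->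
  \sum_(s | P s) F s * (cycprod M s c * K s) =
  \sum_(s | P s) F s * (qreal (qre (cycprod M s c)) * K s).
Proof.
move=> hP hF hK hM; set S := LHS.
have S2 : S = \sum_(s | P s) F s * (qconj (cycprod M s c) * K s).
  rewrite /S (reindex_inj (can_inj (flipK c))) /=.
  apply: eq_big => [s|s].
    by apply/idP/idP=> [/hP|]; [rewrite flipK | apply: hP].
  move/hP; rewrite flipK => Ps.
  by rewrite hF ?hK ?cycprod_flip // => x y; apply: hM.
(* Adding the two expressions for [S] turns each cycle product q into q + conj q = 2 Re q; the
   factor 2 is then cancelled. *)
apply: quat_addrr_inj; rewrite {1}S2 -!big_split /=; apply: eq_bigr => s _.
rewrite -[LHS]mulrDr -[RHS]mulrDr -[in LHS]mulrDl -[in RHS]mulrDl.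
by rewrite [qconj _ + _]addrC addr_qconj mulr2n rmorphD.
Qed.

End Flip.

(** * Determinants as sums of real cycle weights *)

Section Symmetrization.
Variables (R : realFieldType) (n : nat).
Local Notation H := (quat R).
Implicit Types (M N : 'M[H]_n) (s t : 'S_n) (i c x : 'I_n).

Lemma sign_porbits s : (-1) ^+ (n - #|porbits s|) = (-1) ^+ s :> H.
Proof.
have le_s : (#|porbits s| <= n)%N.
  by apply: leq_trans (leq_imset_card _ _) _; rewrite card_ord.
by rewrite -signr_odd oddB // /odd_perm card_ord.
Qed.

Variables (M : 'M[H]_n) (i : 'I_n).
Hypothesis hM : forall x y, x != i -> y != i -> qconj (M x y) = M y x.

Let L s x := cyc_leader s x && (x \notin porbit s i).

(* Cycles led by a member of [D] already contribute their real part only. *)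
Let hybrid (r D : seq 'I_n) s : H :=
  (-1) ^+ s * qreal (\prod_(x <- D | L s x) qre (cycprod M s x)) *
  ((\prod_(x <- r | L s x) cycprod M s x) * cycprod M s i).

(** The factors averaged so far are real, hence central, so the leftmost remaining cycle can be
    averaged behind them. Permutations in which [c] leads no cycle avoiding [i] have no factor for
    [c]. Uniqueness keeps [c] apart from the other leaders, whose cycles are untouched by the
    reversal. *)
Let hybrid_step c r D : uniq (c :: r ++ D) ->
  \sum_s hybrid (c :: r) D s = \sum_s hybrid r (c :: D) s.
Proof.
move=> /= /andP[]; rewrite mem_cat negb_or => /andP[cr cD] _.
rewrite (bigID (L^~ c)) [RHS](bigID (L^~ c)) /=; congr (_ + _); last first.
  by apply: eq_bigr => s /negbTE Lc; rewrite /hybrid !big_cons Lc.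
have Lflip s x : L (flip s c) x = L s x.
  by rewrite /L porbit_flip (eq_cyc_leader (porbit_flip s c x)).
have Lneq s x : L s c -> L s x -> x != c -> x \notin porbit s c.
  move=> /andP[cL _] /andP[xL _] /eqP xc; apply/negP=> xpc; apply: xc.
  exact: (cyc_leader_uniq xL cL).
pose F s := (-1) ^+ s * qreal (\prod_(x <- D | L s x) qre (cycprod M s x)).
pose K s := \prod_(x <- r | L s x) cycprod M s x * cycprod M s i.
transitivity (\sum_(s | L s c) F s * (cycprod M s c * K s)).
  by apply: eq_bigr => s Lc; rewrite /hybrid big_cons Lc /F /K !mulrA.
rewrite (sum_flip (P := L^~ c)).
- apply: eq_bigr => s Lc; rewrite /hybrid big_cons Lc rmorphM /F /K.
  by rewrite [qreal (qre _) * qreal _]qrealC !mulrA.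
- by move=> s; rewrite Lflip.
- move=> s Lc; rewrite /F odd_flip; congr (_ * qreal _).
  rewrite big_seq_cond [RHS]big_seq_cond; apply: eq_big => [x|x /andP[xD]];
  rewrite Lflip // => Lx.
  rewrite cycprod_flip_out //; apply: Lneq => //.
    by apply: contraNneq cD => <-.
- move=> s Lc; rewrite /K; congr (_ * _); last first.
    by rewrite cycprod_flip_out // porbit_sym; case/andP: Lc.
  rewrite big_seq_cond [RHS]big_seq_cond; apply: eq_big => [x|x /andP[xD]];
  rewrite Lflip // => Lx.
  rewrite cycprod_flip_out //; apply: Lneq => //.
    by apply: contraNneq cr => <-.
- move=> s x y /andP[_ ci] xc yc; apply: hM; apply: contraNneq ci => <-;
  by rewrite porbit_sym.
Qed.

(** Only cycles avoiding [i] are averaged, so symmetry off row and column [i] is enough. This admits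
    a Hermitian matrix whose column [i] has been replaced. *)
Lemma cdet_symmetrized :
  cdet M i = \sum_(s : 'S_n) (-1) ^+ s *
    (qreal (cycweight M s (~: porbit s i)) * cycprod M s i).
Proof.
have hybrid_all r D : uniq (r ++ D) ->
    \sum_s hybrid r D s = \sum_s hybrid [::] (catrev r D) s.
  elim: r D => //= c r IH D /[dup] /hybrid_step -> /andP[cN Ur].
  by apply: IH; rewrite -cat1s uniq_catCA /= cN.
transitivity (\sum_s hybrid (rev (enum 'I_n)) [::] s).
  apply: eq_bigr => s _; rewrite sign_porbits /hybrid big_nil rmorph1 mulr1.
  by congr (_ * (_ * _)); apply: eq_bigl.
rewrite hybrid_all ?cats0 ?rev_uniq ?enum_uniq //.
rewrite -[catrev _ _]/(rev (rev (enum 'I_n))) revK.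
apply: eq_bigr => s _; rewrite /hybrid big_nil mul1r mulrA.
congr (_ * qreal _ * _).
rewrite big_enum_cond; apply: eq_bigl => x; rewrite !inE /L andbC.
by case: (cyc_leader s x); rewrite /= ?andbF ?andbT.
Qed.

End Symmetrization.

(** * Extension of permutations along an increasing sequence *)

Lemma ord_mono_inj k n (b : 'I_k -> 'I_n) :
  (forall u v, (b u <= b v)%N = (u <= v)%N) -> injective b.
Proof.
by move=> hb u v e; apply/val_inj/eqP; rewrite eqn_leq -!hb e leqnn.
Qed.

Section PermExtension.
Variables (k n : nat) (b : 'I_k -> 'I_n).
Hypothesis b_mono : forall u v, (b u <= b v)%N = (u <= v)%N.
Implicit Types (s : 'S_k) (u v : 'I_k) (x : 'I_n).

Let b_inj : injective b := ord_mono_inj b_mono.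

(** Extension by the identity puts the permutations of all principal submatrices into the single
    group ['S_n]. Since [b] is monotone, the smallest element of a cycle stays the smallest. *)
Definition perm_ext_fun s x :=
  if [pick u | b u == x] is Some u then b (s u) else x.

Let perm_ext_fun_b s u : perm_ext_fun s (b u) = b (s u).
Proof.
rewrite /perm_ext_fun; case: pickP => [v /eqP /b_inj -> //|/(_ u)].
by rewrite eqxx.
Qed.

Let perm_ext_fun_out s x :
  x \notin [set b u | u in 'I_k] -> perm_ext_fun s x = x.
Proof.
move=> xb; rewrite /perm_ext_fun; case: pickP => // v /eqP e.
by case/negP: xb; rewrite -e imset_f.
Qed.

Lemma perm_ext_fun_inj s : injective (perm_ext_fun s).
Proof.
move=> x y.
have [/imsetP[u _ ->]|xb] := boolP (x \in [set b u | u in 'I_k]);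
have [/imsetP[v _ ->]|yb] := boolP (y \in [set b u | u in 'I_k]);
rewrite ?perm_ext_fun_b ?perm_ext_fun_out //.
- by move=> /b_inj/perm_inj ->.
- by move=> e; case/negP: yb; rewrite -e imset_f.
- by move=> e; case/negP: xb; rewrite e imset_f.
Qed.

Definition perm_ext s : 'S_n := perm (@perm_ext_fun_inj s).

Lemma perm_extE s u : perm_ext s (b u) = b (s u).
Proof. by rewrite permE perm_ext_fun_b. Qed.

Lemma perm_ext_out s x : x \notin [set b u | u in 'I_k] -> perm_ext s x = x.
Proof. by move=> xb; rewrite permE perm_ext_fun_out. Qed.

Lemma perm_ext_on s : perm_on [set b u | u in 'I_k] (perm_ext s).
Proof.
by apply/subsetP=> x; rewrite inE; apply: contraR => xb; rewrite perm_ext_out.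
Qed.

Lemma perm_ext_inj : injective perm_ext.
Proof.
move=> s t e; apply/permP=> u; apply: b_inj.
by rewrite -!perm_extE e.
Qed.

Lemma sum_perm_on (V : nmodType) (F : 'S_n -> V) :
  \sum_(t | perm_on [set b u | u in 'I_k] t) F t = \sum_s F (perm_ext s).
Proof.
transitivity (\sum_(t in [set perm_ext s | s in 'S_k]) F t).
  apply: eq_bigl => t; rewrite -[LHS](in_set (perm_on _)).
  suff -> : [set perm_ext s | s in 'S_k] =
            [set t | perm_on [set b u | u in 'I_k] t] by [].
  (* Both sets have k! elements, so one inclusion suffices. *)
  apply/eqP; rewrite eqEcard; apply/andP; split.
    by apply/subsetP=> _ /imsetP[s _ ->]; rewrite inE perm_ext_on.
  rewrite card_imset; last exact: perm_ext_inj.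
  by rewrite cardsE card_perm card_imset // card_ord card_Sn.
by rewrite big_imset //= => s t _ _; apply: perm_ext_inj.
Qed.

Lemma perm_extM s t : perm_ext (s * t)%g = (perm_ext s * perm_ext t)%g.
Proof.
apply/permP=> x; rewrite permM.
have [/imsetP[u _ ->]|xb] := boolP (x \in [set b u | u in 'I_k]).
  by rewrite !perm_extE permM.
by rewrite !perm_ext_out.
Qed.

Lemma perm_ext_tperm u v : perm_ext (tperm u v) = tperm (b u) (b v).
Proof.
apply/permP=> x.
have [/imsetP[w _ ->]|xb] := boolP (x \in [set b u | u in 'I_k]).
  by rewrite perm_extE inj_tperm.
rewrite perm_ext_out // tpermD //; apply: contraNneq xb => <-; exact: imset_f.
Qed.

Lemma perm_ext1 : perm_ext 1%g = 1%g.
Proof. by apply: (mulIg (perm_ext 1)); rewrite -perm_extM !mul1g. Qed.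

Lemma odd_perm_ext s : odd_perm (perm_ext s) = odd_perm s.
Proof.
have [ts -> _] := prod_tpermP s; elim: ts => [|[u v] ts IH].
  by rewrite big_nil perm_ext1 !odd_perm1.
by rewrite big_cons perm_extM !odd_permM perm_ext_tperm !odd_tperm inj_eq // IH.
Qed.

Lemma perm_extX s u j : (perm_ext s ^+ j)%g (b u) = b ((s ^+ j)%g u).
Proof.
by elim: j => [|j IH]; rewrite ?expg0 ?perm1 // !permXS IH perm_extE.
Qed.

Lemma porbit_perm_ext s u :
  porbit (perm_ext s) (b u) = [set b v | v in porbit s u].
Proof.
apply/setP=> x; apply/porbitP/imsetP=> [[j ->]|[v /porbitP[j ->] ->]].
  by exists ((s ^+ j)%g u); rewrite ?mem_porbit // perm_extX.
by exists j; rewrite perm_extX.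
Qed.

Lemma cyc_leader_perm_ext s u : cyc_leader (perm_ext s) (b u) = cyc_leader s u.
Proof.
apply/forall_inP/forall_inP=> h v; rewrite ?porbit_perm_ext.
  by move=> vu; rewrite -b_mono h // porbit_perm_ext imset_f.
by case/imsetP=> w wu ->; rewrite b_mono h.
Qed.

Section Transfer.
Variable R : realFieldType.
Local Notation H := (quat R).
Variable N : 'M[H]_n.

Lemma cycprod_perm_ext s u :
  cycprod N (perm_ext s) (b u) = cycprod (mxsub b b N) s u.
Proof.
rewrite !cycprodE porbit_perm_ext card_imset //.
by apply: eq_bigr => j _; rewrite mxE !perm_extX.
Qed.

Lemma cycweight_perm_ext s u :
  cycweight N (perm_ext s)
    ([set b v | v in 'I_k] :\: porbit (perm_ext s) (b u)) =
  cycweight (mxsub b b N) s (~: porbit s u).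
Proof.
have -> : [set b v | v in 'I_k] :\: porbit (perm_ext s) (b u) =
          [set b v | v in ~: porbit s u].
  rewrite porbit_perm_ext; apply/setP=> x; rewrite inE.
  apply/andP/imsetP=> [[xN /imsetP[v _ e]]|[v vN ->]].
    by exists v => //; rewrite inE; apply: contra xN => vu; rewrite e imset_f.
  by rewrite mem_imset // imset_f //; rewrite inE in vN.
rewrite /cycweight big_imset_cond /=; last by move=> v w _ _; apply: b_inj.
apply: eq_big => [v|v _]; first by rewrite cyc_leader_perm_ext.
by rewrite cycprod_perm_ext.
Qed.

End Transfer.
End PermExtension.

Section PermOn.
Variable T : finType.
Implicit Types (s t : {perm T}) (B : {set T}) (i j x : T).

Lemma porbit_perm_on s B i : perm_on B s -> i \in B -> porbit s i \subset B.
Proof.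
move=> sB iB; apply/subsetP=> _ /porbitP[k ->]; elim: k => [|k IH].
  by rewrite expg0 perm1.
by rewrite permXS perm_closed.
Qed.

Lemma porbit_fix s i : s i = i -> porbit s i = [set i].
Proof.
move=> si; apply/setP=> y; rewrite inE; apply/idP/eqP=> [/porbitP[k ->]|->].
  exact: permX_fix.
exact: porbit_id.
Qed.

Lemma perm_onD1 s B i : perm_on (B :\ i) s = perm_on B s && (s i == i).
Proof.
apply/idP/andP=> [sB|[sB /eqP si]].
  split; first exact: subset_trans sB (subsetDl _ _).
  by rewrite (out_perm sB) // !inE eqxx.
apply/subsetP=> x sx; rewrite !inE (subsetP sB x sx) andbT.
by apply: contraTneq sx => ->; rewrite inE si eqxx.
Qed.

Lemma perm_on_tperm s B i j : i \in B -> j \in B ->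
  perm_on B (s * tperm i j)%g = perm_on B s.
Proof.
move=> iB jB; have tB : perm_on B (tperm i j).
  by apply: subset_trans (tperm_on i j) _; rewrite subUset !sub1set iB.
apply/idP/idP=> sB; last exact: perm_onM.
by rewrite -[s]mulg1 -(tperm2 i j) mulgA perm_onM.
Qed.

End PermOn.

(** * Averaged minors, cofactors and Cramer's rule *)

Section MooreDeterminant.
Variables (R : realFieldType) (n : nat).
Local Notation H := (quat R).
Implicit Types (M N G : 'M[H]_n) (s t : 'S_n) (i j x : 'I_n) (B : {set 'I_n}).

(* [mdet M B] is the principal minor on [B] when [M] is Hermitian, and
   [adet N B i] is cdet_i of the principal submatrix on [B] when [N] is
   Hermitian off row and column [i]; in both, cycles have been averaged with
   their inverses. In [cof] the condition [s j == i] and the missing last factor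
   of the cycle product amount to replacing column [i] by the unit vector
   e_j. *)
Definition mdet M B : R := \sum_(s | perm_on B s) (-1) ^+ s * cycweight M s B.

Definition adet N B i : H :=
  \sum_(s | perm_on B s)
    (-1) ^+ s * (qreal (cycweight N s (B :\: porbit s i)) * cycprod N s i).

Definition cof G B i j : H :=
  \sum_(s | perm_on B s && (s j == i))
    (-1) ^+ s * (qreal (cycweight G s (B :\: porbit s i)) * pathprod G s i).

Lemma mdet0 M : mdet M set0 = 1.
Proof.
rewrite /mdet (bigD1 1%g) ?perm_on1 //= big1 => [|s /andP[s0 s1]].
  by rewrite odd_perm1 /cycweight big1 ?mulr1 ?addr0 // => x; rewrite inE.
by case/eqP: s1; apply: (perm_on_id s0); rewrite cards0.
Qed.

(** For a matrix that is Hermitian everywhere the cycle through [i] can be averaged too, after which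
    nothing depends on [i]. *)
Lemma adet_herm G B i : qherm G -> i \in B -> adet G B i = qreal (mdet G B).
Proof.
move=> hG iB; rewrite /adet.
under eq_bigr => s _ do rewrite mulrA -[cycprod G s i]mulr1.
rewrite (sum_flip (P := perm_on B)
  (F := fun s => (-1) ^+ s * qreal (cycweight G s (B :\: porbit s i)))
  (K := fun=> 1)) //.
- rewrite rmorph_sum; apply: eq_bigr => s sB.
  rewrite (cycweight_split G (porbit_perm_on sB iB)) !rmorphM /= -qreal_sign.
  by rewrite mulr1 -mulrA -[in RHS]qrealC.
- by move=> s; apply: perm_on_flip.
- move=> s sB; rewrite odd_flip porbit_flip cycweight_flip //.
  by rewrite -setI_eq0 setIDAC setDIl setDv setI0.
- by move=> s x y _ _ _; apply: qhermE.
Qed.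

(* Merging and splitting cycles through [i] and [j] is a sign-reversing
   involution on the permutations of [B]. *)
Lemma adet_eq_col N B i j :
  (forall x y, x != i -> y != i -> qconj (N x y) = N y x) ->
  (forall x, N x i = N x j) -> i \in B -> j \in B -> i != j -> adet N B i = 0.
Proof.
move=> hN Nij iB jB ij; rewrite /adet.
(* Permutations with [i] and [j] on one cycle are matched, through multiplication by [tperm i j],
   with those having them on two cycles. *)
rewrite (bigID (fun s : 'S_n => j \in porbit s i)) /=.
rewrite (reindex_inj (mulIg (tperm i j))) /=.
pose P (s : 'S_n) := perm_on B s && (j \notin porbit s i).
pose D (s : 'S_n) := B :\: (porbit s i :|: porbit s j).
pose F (s : 'S_n) : H :=
  - ((-1) ^+ s * (qreal (cycweight N s (D s)) * cycprod N s i)).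
have -> : \sum_(s | perm_on B (s * tperm i j)%g &&
                     (j \in porbit (s * tperm i j)%g i))
   (-1) ^+ (s * tperm i j)%g *
   (qreal (cycweight N (s * tperm i j)%g (B :\: porbit (s * tperm i j)%g i)) *
    cycprod N (s * tperm i j)%g i) = \sum_(s | P s) F s * (cycprod N s j * 1).
  apply: eq_big => [s|s /andP[]].
    by rewrite perm_on_tperm // porbit_mul_tperm.
  rewrite perm_on_tperm // porbit_mul_tperm // => sB ji.
  have -> : cycprod N (s * tperm i j)%g i = cycprod N s i * cycprod N s j.
    by rewrite cycprod_merge // !cycprod_last !Nij.
  have -> : cycweight N (s * tperm i j)%g (B :\: porbit (s * tperm i j)%g i) =
            cycweight N s (D s).
    rewrite porbit_merge //; apply: eq_cycweight => // x y /setDP[_ xN] yx.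
    apply: merge_out => //; rewrite porbit_merge //; apply: contra xN.
    rewrite !inE => /orP[] yo;
    rewrite -(porbit_sub yo) [x \in porbit s y]porbit_sym;
    by rewrite yx ?orbT.
  rewrite odd_permM odd_tperm ij signr_addb expr1 mulrN1 /F mulr1 !mulNr.
  by rewrite !mulrA.
have sub_j s : perm_on B s -> j \notin porbit s i ->
    porbit s j \subset B :\: porbit s i.
  move=> sB ji; apply/subsetP=> x xj; rewrite inE.
  rewrite (subsetP (porbit_perm_on sB jB)) // andbT.
  by apply: contra ji => xi; rewrite -(porbit_sub xi) porbit_sym.
(* The merged term carries the full product of the cycle of [j], the split term only its real part.
   That cycle avoids [i], so it can be averaged, and then the terms cancel. *)
rewrite (sum_flip (P := P)) //.
- rewrite -big_split big1 //= => s /andP[sB ji].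
  rewrite (cycweight_split N (sub_j s sB ji)) setDDl rmorphM /F -/(D s) mulr1.
  rewrite mulNr -qrealC mulrA [qreal _ * (-1) ^+ _]qrealC !mulrA.
  exact: addNr.
- by move=> s; rewrite /P porbit_flip => /andP[/perm_on_flip -> ->].
- move=> s /andP[sB ji]; rewrite /F /D odd_flip !porbit_flip cycprod_flip_out.
    rewrite cycweight_flip // -setI_eq0; apply/eqP/setP=> x; rewrite !inE.
    by case: (x \in porbit s j); rewrite ?orbT ?andbF.
  by rewrite porbit_sym.
- move=> s x y /andP[_ ji] xj yj; apply: hN; apply: contraNneq ji => <-;
  by rewrite porbit_sym.
Qed.

Section Cofactors.
Variable G : 'M[H]_n.
Hypothesis hG : qherm G.

Lemma pathprod_colrep s i v : pathprod (colrep G i v) s i = pathprod G s i.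
Proof. by apply: eq_pathprod => // y _ /negbTE yi; rewrite mxE yi. Qed.

Lemma cycweight_colrep s B i v :
  cycweight (colrep G i v) s (B :\: porbit s i) =
  cycweight G s (B :\: porbit s i).
Proof.
apply: eq_cycweight => // x y /setDP[_ xi] yx; rewrite mxE ifN //.
by apply: contraNneq xi => <-; rewrite porbit1 porbit_sym.
Qed.

(** Laplace expansion along column [i]: the permutations are sorted by the row j = s^-1(i) of the
    closing factor, the only one taken from the new column. *)
Lemma adet_colrep B i v :
  adet (colrep G i v) B i = \sum_j cof G B i j * v j 0.
Proof.
rewrite /adet (partition_big (fun s : 'S_n => (s^-1)%g i) predT) //=.
apply: eq_bigr => j _; rewrite /cof mulr_suml.
have sij s : ((s^-1)%g i == j) = (s j == i).
  by rewrite -(inj_eq (@perm_inj _ s)) permKV eq_sym.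
apply: eq_big => [s|s]; rewrite sij // => /andP[_ /eqP sj].
rewrite cycweight_colrep cycprod_last pathprod_colrep mxE eqxx -!mulrA.
by rewrite [in RHS](canRL (permK s) sj).
Qed.

Lemma colrep_col i : colrep G i (col i G) = G.
Proof. by apply/matrixP=> x y; rewrite !mxE; case: eqP => // ->. Qed.

Lemma cof_mul_diag B i : i \in B ->
  \sum_k cof G B i k * G k i = qreal (mdet G B).
Proof.
move=> iB; rewrite -(adet_herm hG iB) -[in RHS](colrep_col i) adet_colrep.
by apply: eq_bigr => k _; rewrite mxE.
Qed.

(** The sum expands the determinant with column [i] replaced by column [j], which has two equal
    columns. *)
Lemma cof_mul_off B i j : i \in B -> j \in B -> i != j ->
  \sum_k cof G B i k * G k j = 0.
Proof.
move=> iB jB ij.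
have a0 : adet (colrep G i (col j G)) B i = 0.
  apply: (adet_eq_col (j := j)) => // [x y xi yi|x].
    by rewrite !mxE (negbTE xi) (negbTE yi) qhermE.
  by rewrite !mxE eqxx eq_sym (negbTE ij).
by rewrite -[RHS]a0 adet_colrep; apply: eq_bigr => k _; rewrite mxE.
Qed.

Lemma cof_out B i j : i \in B -> j \notin B -> cof G B i j = 0.
Proof.
move=> iB jB; rewrite /cof big1 // => s /andP[sB /eqP sj].
by case/negP: jB; rewrite -(perm_closed _ sB) sj.
Qed.

Lemma pathprod_fix s i : s i = i -> pathprod G s i = 1.
Proof. by move=> si; rewrite /pathprod porbit_fix // cards1 big_nil. Qed.

Lemma cof_diag B i : i \in B -> cof G B i i = qreal (mdet G (B :\ i)).
Proof.
move=> iB; rewrite /cof rmorph_sum; apply: eq_big => [s|s].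
  by rewrite perm_onD1.
case/andP=> _ /eqP si; rewrite porbit_fix // pathprod_fix // mulr1.
by rewrite rmorphM /= -qreal_sign.
Qed.

(** Right multiplication by [tperm i j] turns the permutations of [B], which fix [j], into those of
    [j |: B] sending [j] to [i]: [j] is inserted at the end of the cycle of [i], and the sign
    changes. *)
Lemma cof_mul_out B i j : i \in B -> j \notin B ->
  \sum_k cof G B i k * G k j = - cof G (j |: B) i j.
Proof.
move=> iB jB; pose N := colrep G i (col j G).
have ij : i != j by apply: contraNneq jB => <-.
transitivity (adet N B i).
  by rewrite adet_colrep; apply: eq_bigr => k _; rewrite mxE.
rewrite /cof (reindex_inj (mulIg (tperm i j))) -sumrN /=.
have jBE : (j |: B) :\ j = B by rewrite setU1K.
apply: eq_big => [s|s sB].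
  rewrite perm_on_tperm ?inE ?eqxx ?iB ?orbT // permM.
  rewrite -(inj_eq (@perm_inj _ (tperm i j))) tpermK tpermL.
  by rewrite -perm_onD1 jBE.
have sj : s j = j by apply: (out_perm sB).
have ji : j \notin porbit s i.
  by apply: contra jB; apply: subsetP; apply: porbit_perm_on.
rewrite odd_permM odd_tperm ij signr_addb expr1 mulrN1 mulNr opprK.
congr (_ * (qreal _ * _)).
  rewrite porbit_merge // /N cycweight_colrep.
  have -> : (j |: B) :\: (porbit s i :|: porbit s j) = B :\: porbit s i.
    rewrite (porbit_fix sj); apply/setP=> x; rewrite !inE.
    case: (eqVneq x j) => [->|] /=; last by rewrite orbF.
    by rewrite orbT /= (negbTE jB) andbF.
  apply/esym/eq_cycweight => // x y /setDP[xB xN] yx; apply: merge_out => //.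
  rewrite porbit_merge // (porbit_fix sj) !inE negb_or; apply/andP; split.
    by apply: contra xN => yi; rewrite -(porbit_sub yi) porbit_sym.
  apply: contraNneq jB => yj; rewrite -yj.
  by apply: (subsetP (porbit_perm_on sB xB)).
(* With ones in column [i] the closing factor is 1, so that the path product becomes a cycle product
   and [cycprod_merge] applies. *)
pose N1 := colrep G i (const_mx 1).
have e : cycprod N1 (s * tperm i j)%g i = pathprod G (s * tperm i j)%g i.
  by rewrite cycprod_last pathprod_colrep !mxE eqxx mulr1.
rewrite -e cycprod_merge // cycprod_last !pathprod_colrep !mxE eqxx mulr1.
rewrite [j == i]eq_sym (negbTE ij) (_ : pathprod N1 s j = 1) ?mulr1 //.
by rewrite /pathprod (porbit_fix sj) cards1 big_nil.
Qed.

End Cofactors.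

End MooreDeterminant.

(** * Increasing sequences as subsets *)

Lemma incr_seq_imset k n (B : {set 'I_n}) : #|B| = k ->
  exists2 b : {ffun 'I_k -> 'I_n}, incr_seq b & B = [set b u | u in 'I_k].
Proof.
move=> <-.
have sB : sorted (fun x y : 'I_n => (x < y)%N) (enum B).
  rewrite /enum_mem; apply: sorted_filter => [x y z|]; first exact: ltn_trans.
  rewrite -enumT -[sorted _ _]/(sorted (relpre (@nat_of_ord n) ltn) _).
  by rewrite -sorted_map val_enum_ord iota_ltn_sorted.
exists [ffun u : 'I_#|B| => enum_val u].
  apply/forallP=> u; apply/forallP=> v; apply/implyP=> uv; rewrite !ffunE.
  move: {2}(enum_val u) (erefl (enum_val u)) => x0 _.
  rewrite (enum_val_nth x0 u) (enum_val_nth x0 v).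
  by apply: (sorted_ltn_nth _ _ sB) => //;
    [exact: ltn_trans | rewrite inE -cardE..].
apply/setP=> x; apply/idP/imsetP=> [xB|[u _ ->]].
  by exists (enum_rank_in xB x) => //; rewrite ffunE enum_rankK_in.
by rewrite ffunE enum_valP.
Qed.

Section IncreasingSequences.
Variables k n : nat.
Implicit Types b : {ffun 'I_k -> 'I_n}.

Lemma incr_seq_mono b : incr_seq b -> forall u v, (b u <= b v)%N = (u <= v)%N.
Proof.
move=> /forallP hb u v; have lt_b (x y : 'I_k) : (x < y)%N -> (b x < b y)%N.
  by move=> xy; move/forallP: (hb x) => /(_ y) /implyP; apply.
case: (ltngtP u v) => [/lt_b/ltnW //|/lt_b|/val_inj ->]; last exact: leqnn.
by rewrite ltnNge => /negbTE.
Qed.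

(** The position of an element in the sequence is recovered from the image as the number of smaller
    elements in it. *)
Lemma imset_incr_seq_inj b c : incr_seq b -> incr_seq c ->
  [set b u | u in 'I_k] = [set c u | u in 'I_k] -> b = c.
Proof.
move=> /incr_seq_mono hb /incr_seq_mono hc e.
have below (d : {ffun 'I_k -> 'I_n}) u :
    (forall u v, (d u <= d v)%N = (u <= v)%N) ->
    #|[set x in [set d v | v in 'I_k] | (x < d u)%N]| =
    #|[set v : 'I_k | (v < u)%N]|.
  move=> hd; rewrite -(card_imset _ (ord_mono_inj hd)); congr #|pred_of_set _|.
  apply/setP=> x; rewrite inE; apply/andP/imsetP=> [[/imsetP[v _ ->]]|[v]].
    by rewrite ltnNge hd -ltnNge => vu; exists v; rewrite // inE.
  by rewrite inE => vu ->; rewrite imset_f // ltnNge hd -ltnNge.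
have lt_card (u v : 'I_k) : (u < v)%N ->
    (#|[set w : 'I_k | (w < u)%N]| < #|[set w : 'I_k | (w < v)%N]|)%N.
  move=> uv; apply/proper_card/properP; split.
    by apply/subsetP=> w; rewrite !inE => wu; apply: ltn_trans wu uv.
  by exists u; rewrite !inE // ltnn.
apply/ffunP=> u; have /imsetP[v _ buv] : b u \in [set c u | u in 'I_k].
  by rewrite -e imset_f.
rewrite buv; congr (c _); have := below b u hb; rewrite e buv below // => cuv.
apply/val_inj; case: (ltngtP v u) => // /lt_card; by rewrite cuv ltnn.
Qed.

Lemma sum_incr_seq (V : nmodType) (F : {set 'I_n} -> V) :
  \sum_(b : {ffun 'I_k -> 'I_n} | incr_seq b) F [set b u | u in 'I_k] =
  \sum_(B : {set 'I_n} | #|B| == k) F B.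
Proof.
pose S := [set b : {ffun 'I_k -> 'I_n} | incr_seq b].
pose im b := [set b u | u in 'I_k].
transitivity (\sum_(b in S) F (im b)).
  by apply: eq_bigl => b; rewrite inE.
rewrite -(big_imset (h := im)) /=; last first.
  by move=> b c; rewrite !inE; apply: imset_incr_seq_inj.
apply: eq_bigl => B; apply/imsetP/eqP=> [[b]|/incr_seq_imset[b hb ->]].
  rewrite inE => /incr_seq_mono hb ->.
  by rewrite card_imset ?card_ord //; apply: ord_mono_inj.
by exists b; rewrite ?inE.
Qed.

End IncreasingSequences.

(** * Row and column determinants of principal submatrices *)

Section RowColumnDeterminants.
Variable R : realFieldType.
Local Notation H := (quat R).

Lemma enum_index_enum (T : finType) : enum T = index_enum T.
Proof. by rewrite enumT [index_enum T]unlock. Qed.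

(** Conjugation puts the cycle of [i] first and the others in increasing order; passing to inverse
    permutations restores the direction of each cycle. *)
Lemma rdet_qadj n (M : 'M[H]_n) i : rdet (qadj M) i = qconj (cdet M i).
Proof.
rewrite /rdet /cdet raddf_sum (reindex_inj invg_inj) /=; apply: eq_bigr => s _.
rewrite porbitsV !qconjM qconj_sign qreal_sign qrealC cycprod_adj.
rewrite [qconj (\prod_(_ <- rev _ | _) _)]qconj_prod revK enum_index_enum.
congr (_ * _ * _); apply: eq_big => [c|c _].
  by rewrite porbitV (eq_cyc_leader (porbitV s c)).
exact: cycprod_adj.
Qed.

Lemma cdet_psubmx k n (N : 'M[H]_n) (b : {ffun 'I_k -> 'I_n}) u :
  incr_seq b ->
  (forall x y, x != b u -> y != b u -> qconj (N x y) = N y x) ->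
  cdet (psubmx N b) u = adet N [set b v | v in 'I_k] (b u).
Proof.
move=> /incr_seq_mono hb hN.
rewrite cdet_symmetrized => [|x y xu yu]; last first.
  by rewrite !mxE hN // (inj_eq (ord_mono_inj hb)).
rewrite /adet (sum_perm_on hb); apply: eq_bigr => s _.
by rewrite odd_perm_ext cycweight_perm_ext cycprod_perm_ext.
Qed.

Lemma hdet_psubmx k n (G : 'M[H]_n) (b : {ffun 'I_k -> 'I_n}) :
  (0 < k)%N -> qherm G -> incr_seq b ->
  hdet (psubmx G b) = qreal (mdet G [set b v | v in 'I_k]).
Proof.
case: k b => // k b _ hG hb /=.
have <- : qadj (psubmx G b) = psubmx G b.
  by apply/matrixP=> x y; rewrite !mxE qhermE.
rewrite rdet_qadj cdet_psubmx // => [|x y _ _]; last exact: qhermE.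
by rewrite adet_herm ?imset_f // qconj_real.
Qed.

End RowColumnDeterminants.

(** * Faddeev-LeVerrier recursion and Gram matrices *)

Section CofactorSums.
Variables (R : realFieldType) (n : nat).
Local Notation H := (quat R).
Implicit Types (G : 'M[H]_n) (B : {set 'I_n}).

(** The real numbers d_k of the recursion; [cofsum] below is the matrix N_k. *)
Definition minorsum G k : R := \sum_(B : {set 'I_n} | #|B| == k) mdet G B.

Definition cofsum G k : 'M[H]_n :=
  \matrix_(i, j) \sum_(B : {set 'I_n} | (#|B| == k) && (i \in B)) cof G B i j.

Lemma minorsum0 G : minorsum G 0 = 1.
Proof.
rewrite /minorsum (big_pred1 set0) ?mdet0 // => B.
by rewrite cards_eq0.
Qed.

Lemma cofsum0 G : cofsum G 0 = 0.
Proof.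
apply/matrixP=> i j; rewrite !mxE big1 // => B.
by rewrite cards_eq0 => /andP[/eqP ->]; rewrite inE.
Qed.

Lemma sum_setU1 (V : nmodType) k (i : 'I_n) (Q : pred {set 'I_n})
    (F : {set 'I_n} -> V) :
  \sum_(B : {set 'I_n} | [&& #|B| == k.+1, i \in B & Q B]) F B =
  \sum_(B : {set 'I_n} | [&& #|B| == k, i \notin B & Q (i |: B)]) F (i |: B).
Proof.
rewrite (reindex_onto (fun B => i |: B) (fun B => B :\ i)) /=; last first.
  by move=> B /and3P[_ iB _]; rewrite setD1K.
apply: eq_bigl => B; rewrite setU11 /=.
case: (boolP (i \in B)) => iB /=; last first.
  by rewrite cardsU1 iB setU1K // eqxx andbT.
rewrite andbF; apply/negP=> /andP[_ /eqP e].
by move: iB; rewrite -e !inE eqxx.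
Qed.

Lemma cofsum_mulE m G k (A : 'M[H]_(n, m)) i j :
  (cofsum G k *m A) i j =
  \sum_(B : {set 'I_n} | (#|B| == k) && (i \in B)) \sum_l cof G B i l * A l j.
Proof.
rewrite mxE exchange_big; apply: eq_bigr => l _ /=.
by rewrite mxE mulr_suml.
Qed.

Section Hermitian.
Variable G : 'M[H]_n.
Hypothesis hG : qherm G.

(** On the diagonal, the minors on sets containing [i] cancel against N_k G by Cramer's rule; each
    remaining set without [i] gives the diagonal cofactor of the set enlarged by [i]. Off the
    diagonal, the sets containing both indices arise by adding [j] to a set without it, where
    [cof_mul_out] applies; all other terms vanish. *)
Lemma cofsum_rec k :
  cofsum G k.+1 = (qreal (minorsum G k))%:M - cofsum G k *m G.
Proof.
apply/matrixP=> i j; rewrite [RHS]mxE [X in _ + X]mxE cofsum_mulE !mxE.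
case: (eqVneq i j) => [<-|ij]; rewrite ?mulr1n ?mulr0n.
  under eq_bigl do rewrite -[i \in _]andbT.
  rewrite sum_setU1 /minorsum rmorph_sum.
  rewrite [X in _ = X - _](bigID (fun B : {set 'I_n} => i \in B)) /=.
  rewrite [X in X + _ - _](eq_bigr (fun B => \sum_l cof G B i l * G l i)).
    rewrite addrAC subrr add0r; apply: eq_big => [B|B]; first by rewrite andbT.
    case/and3P=> _ iB _; rewrite cof_diag ?setU11 // setU1K //.
  by move=> B /andP[_ iB]; rewrite cof_mul_diag.
rewrite sub0r (bigID (fun B : {set 'I_n} => j \in B)) /=.
rewrite [X in _ + X]big1 ?addr0; last first.
  by move=> B /andP[/andP[_ iB] jB]; apply: cof_out.
rewrite [X in _ = - X](bigID (fun B : {set 'I_n} => j \in B)) /=.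
rewrite [X in - (X + _)]big1 ?add0r; last first.
  by move=> B /andP[/andP[_ iB] jB]; apply: cof_mul_off.
under eq_bigl do rewrite -andbA [(i \in _) && _]andbC.
rewrite (sum_setU1 k j (fun B => i \in B)) -sumrN; apply: eq_big => [B|B].
  by rewrite !inE (negbTE ij) /= andbA andbAC.
case/and3P=> _ jB; rewrite !inE (negbTE ij) /= => iB.
by rewrite cof_mul_out ?opprK.
Qed.

(** Each minor of order [k] is counted once for every index of its set. *)
Lemma minorsum_trace k : qre (\tr (cofsum G k *m G)) = minorsum G k *+ k.
Proof.
rewrite raddf_sum /=.
under eq_bigr => i _.
  rewrite cofsum_mulE raddf_sum /=.
  under eq_bigr => B /andP[_ iB] do rewrite cof_mul_diag // qrealK.
  over.
rewrite (exchange_big_dep (fun B : {set 'I_n} => #|B| == k)) /=; last first.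
  by move=> i B _ /andP[].
rewrite /minorsum -sumrMnl; apply: eq_bigr => B /eqP cB.
by rewrite -cB -sumr_const; apply: eq_bigl => i; rewrite cB eqxx.
Qed.

(** By the recursion N_k is a polynomial in [G] with real, hence central, coefficients. *)
Lemma cofsum_comm k : cofsum G k *m G = G *m cofsum G k.
Proof.
elim: k => [|k IH]; first by rewrite cofsum0 mul0mx mulmx0.
by rewrite cofsum_rec mulmxBl mulmxBr scalar_mx_realC [in RHS]mulmxA -IH.
Qed.

Lemma qherm_cofsum k : qherm (cofsum G k).
Proof.
elim: k => [|k IH].
  rewrite /qherm cofsum0; apply/matrixP=> i j; rewrite !mxE.
  exact: (raddf0 (@qconj R)).
by rewrite /qherm cofsum_rec qadjB qadj_scalar qadjM IH hG cofsum_comm.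
Qed.

End Hermitian.
End CofactorSums.

(** * Gram matrices, rank and the Moore-Penrose inverse *)

Section Gram.
Variable R : realFieldType.
Local Notation H := (quat R).

Lemma qherm_gram m n (A : 'M[H]_(m, n)) : qherm (qadj A *m A).
Proof. by rewrite /qherm qadjM qadjK. Qed.

Lemma qherm_gramr m n (A : 'M[H]_(m, n)) : qherm (A *m qadj A).
Proof. by rewrite /qherm qadjM qadjK. Qed.

Variables (m n : nat) (A : 'M[H]_(m, n)).
Local Notation G := (qadj A *m A).
Implicit Types B : {set 'I_n}.

(* The recursion [cofsum_rec] is driven by traces, which agree for [A* A] and
   [A A*]; hence no comparison of row and column ranks is needed. *)
Lemma minorsum_cofsum_gramC k :
  cofsum G k *m qadj A = qadj A *m cofsum (A *m qadj A) k /\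
  minorsum G k = minorsum (A *m qadj A) k.
Proof.
have minorE j : cofsum G j *m qadj A = qadj A *m cofsum (A *m qadj A) j ->
    minorsum G j = minorsum (A *m qadj A) j.
  (* At order 0 the trace identity reads 0 = 0, so this case is separate; otherwise the factor j + 1
     can be cancelled. *)
  case: j => [|j] e; first by rewrite !minorsum0.
  apply: (@pmulrnI _ j.+1) => //.
  rewrite -minorsum_trace; last exact: qherm_gram.
  rewrite -minorsum_trace; last exact: qherm_gramr.
  by rewrite mulmxA e -mulmxA qre_trmxC -mulmxA.
suff e : cofsum G k *m qadj A = qadj A *m cofsum (A *m qadj A) k.
  by split=> //; apply: minorE.
elim: k => [|k IH]; first by rewrite !cofsum0 mul0mx mulmx0.
rewrite cofsum_rec; last exact: qherm_gram.
rewrite cofsum_rec; last exact: qherm_gramr.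
rewrite mulmxBl mulmxBr scalar_mx_realC (minorE k IH); congr (_ - _).
by rewrite !mulmxA IH.
Qed.

(** The cofactor row x is supported on [B], and x G vanishes on [B] except at [i]. Hence x G x* has
    a single term, the product of the minor and the diagonal cofactor. *)
Lemma cof_gram_row B i : i \in B ->
  let y := \row_l cof G B i l *m qadj A in
  (y *m qadj y) 0 0 = qreal (mdet G B * mdet G (B :\ i)).
Proof.
move=> iB; set x := \row_l _ => y.
have hG := qherm_gram A.
rewrite /y qadjM qadjK mulmxA -[x *m _ *m _]mulmxA mxE (bigD1 i) //= big1.
  rewrite addr0 [qadj x _ _]mxE [x 0 i]mxE cof_diag // qconj_real rmorphM /=.
  congr (_ * _); rewrite mxE -(cof_mul_diag hG iB).
  by apply: eq_bigr => l _; rewrite mxE.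
move=> j ij; case: (boolP (j \in B)) => jB.
  rewrite mxE (eq_bigr (fun l => cof G B i l * G l j)); last first.
    by move=> l _; rewrite mxE.
  by rewrite cof_mul_off 1?eq_sym // mul0r.
by rewrite [qadj x _ _]mxE [x 0 j]mxE cof_out // (raddf0 (@qconj R)) mulr0.
Qed.

Lemma mdet_gram_eq0 B i j : i \in B -> mdet G B = 0 ->
  \sum_l cof G B i l * qadj A l j = 0.
Proof.
move=> iB d0; have := cof_gram_row iB; rewrite d0 mul0r /=.
set y := _ *m qadj A => y0; have := mulmx_qadj_qre_eq0 (A := y) (i := 0).
rewrite y0 => /(_ erefl) /rowP /(_ j); rewrite !mxE => yj0.
by rewrite -[RHS]yj0; apply: eq_bigr => l _; rewrite !mxE.
Qed.

(** A relation among the columns is also one among the columns of [G], and Cramer's rule multiplies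
    each coefficient by the minor to get 0. *)
Lemma mdet_gram_indep B : mdet G B != 0 -> right_indep_cols A B.
Proof.
move=> d0 c hc i iB; have hG := qherm_gram A.
have Gc k : \sum_(j in B) G k j * c j = 0.
  under eq_bigr do rewrite mxE mulr_suml.
  rewrite exchange_big big1 //= => l _.
  under eq_bigr do rewrite -mulrA.
  by rewrite -mulr_sumr hc mulr0.
have dc : qreal (mdet G B) * c i = 0.
  transitivity (\sum_(j in B) (\sum_k cof G B i k * G k j) * c j).
    rewrite (bigD1 i) //= cof_mul_diag // big1 ?addr0 // => j /andP[jB ji].
    by rewrite cof_mul_off 1?eq_sym // mul0r.
  under eq_bigr do rewrite mulr_suml.
  rewrite exchange_big big1 //= => k _.
  under eq_bigr do rewrite -mulrA.
  by rewrite -mulr_sumr Gc mulr0.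
rewrite -[c i]mul1r -(rmorph1 (@qreal R)) -(mulVf d0) rmorphM.
by rewrite -mulrA dc mulr0.
Qed.

Lemma right_indep_sub B (C : {set 'I_n}) : C \subset B ->
  right_indep_cols A B -> right_indep_cols A C.
Proof.
move=> /subsetP CB hB c hc k kC.
have := hB (fun j => if j \in C then c j else 0) _ k (CB k kC).
rewrite kC; apply=> i; rewrite -[RHS](hc i) big_mkcond [RHS]big_mkcond /=.
apply: eq_bigr => j _; case: (boolP (j \in C)) => [/CB -> //|_].
by case: ifP; rewrite ?mulr0.
Qed.

(** Induction on the size of [B]: as the minor on [B :\ i] is positive, positivity of x G x* makes
    the minor on [B] nonnegative. *)
Lemma mdet_gram_gt0 B : right_indep_cols A B -> 0 < mdet G B.
Proof.
have [k] := ubnP #|B|; elim: k B => // k IH B Bk hB.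
have [->|[i iB]] := set_0Vmem B; first by rewrite mdet0 ltr01.
have d_gt0 : 0 < mdet G (B :\ i).
  apply: IH; last exact: (right_indep_sub (subsetDl B [set i])).
  by move: Bk; rewrite (cardsD1 i) iB.
have := cof_gram_row iB; set y := _ *m qadj A => /= yE.
have y_ge0 := mulmx_qadj_qre_ge0 y 0; rewrite yE qrealK pmulr_lge0 // in y_ge0.
rewrite lt_def y_ge0 andbT; apply/eqP=> d0.
(* If the minor vanished, the conjugated cofactors would be a relation among the columns in [B],
   with the positive minor on [B :\ i] as coefficient at [i]. *)
have /(hB (fun l => qconj (cof G B i l))) /(_ i iB) :
    forall j, \sum_(l in B) A j l * qconj (cof G B i l) = 0.
  move=> j; rewrite -[RHS](raddf0 (@qconj R)).
  rewrite -[in RHS](mdet_gram_eq0 j iB d0) raddf_sum /=.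
  rewrite [LHS]big_mkcond; apply: eq_bigr => l _; rewrite qconjM mxE qconjK.
  by case: ifPn => // lB; rewrite cof_out // (raddf0 (@qconj R)) mulr0.
rewrite cof_diag // qconj_real => /(congr1 (@qre R)); rewrite qrealK => di0.
by rewrite di0 ltxx in d_gt0.
Qed.

(** A maximal independent set of columns gives a positive term; any other nonzero minor has
    independent columns and is positive too. *)
Lemma minorsum_rank_gt0 r : qrank_is A r -> 0 < minorsum G r.
Proof.
case=> -[S [cS hS]] _; rewrite /minorsum (bigD1 S) ?cS //=.
apply: ltr_pwDl; first exact: mdet_gram_gt0.
apply: sumr_ge0 => B _; case: (eqVneq (mdet G B) 0) => [-> //|d0].
by apply/ltW/mdet_gram_gt0/mdet_gram_indep.
Qed.

Lemma cofsum_rank_eq0 r : qrank_is A r -> cofsum G r.+1 *m qadj A = 0.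
Proof.
case=> _ hr; apply/matrixP=> i j; rewrite cofsum_mulE [RHS]mxE big1 // => B.
case/andP=> /eqP cB iB; apply: mdet_gram_eq0 => //; apply/eqP/negPn/negP.
by move/mdet_gram_indep/hr; rewrite cB ltnn.
Qed.

Lemma MP_inverse_cofsum r (Ap : 'M[H]_(n, m)) :
  qrank_is A r -> is_MP_inverse A Ap ->
  (qreal (minorsum G r))%:M *m Ap = cofsum G r *m qadj A.
Proof.
move=> hr [h1 h2 h3 h4].
have AE : qadj A *m A *m Ap = qadj A by rewrite -mulmxA -h3 -qadjM h1.
have ApE : Ap = qadj A *m (qadj Ap *m Ap) by rewrite mulmxA -qadjM h4 h2.
(* This says d_r A* = N_r G A*. Multiplying on the right by (A+)* A+ gives d_r A+ on the left and,
   since A* A A+ = A*, N_r A* on the right. *)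
have := cofsum_rank_eq0 hr; rewrite cofsum_rec; last exact: qherm_gram.
rewrite mulmxBl => /eqP; rewrite subr_eq0 => /eqP e.
rewrite {1}ApE mulmxA e -!mulmxA [qadj A *m (qadj Ap *m _)]mulmxA.
by rewrite -[qadj A *m qadj Ap]qadjM h4 h2 [qadj A *m (A *m _)]mulmxA AE.
Qed.

End Gram.

(** * Sums over increasing sequences *)

Section Assembly.
Variables (R : realFieldType) (n r : nat).
Local Notation H := (quat R).
Variable G : 'M[H]_n.
Hypothesis hG : qherm G.

(** For each sequence the inner sum has one term or none, according to whether [i] occurs. The
    expansions along column [i] then add up to an entry of N_r A. *)
Lemma sum_cdet_psubmx m (A : 'M[H]_(n, m)) i j :
  \sum_(b : {ffun 'I_r -> 'I_n} | incr_seq b) \sum_(k | b k == i)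
    cdet (psubmx (colrep G i (col j A)) b) k = (cofsum G r *m A) i j.
Proof.
rewrite cofsum_mulE [RHS]big_mkcondr /= -sum_incr_seq.
apply: eq_bigr => b hb.
case: (boolP (i \in [set b u | u in 'I_r])) => [/imsetP[u _ iu]|iN].
  rewrite (big_pred1 u) => [|v]; last first.
    by rewrite iu (inj_eq (ord_mono_inj (incr_seq_mono hb))).
  rewrite iu cdet_psubmx // => [|x y xu yu].
    by rewrite adet_colrep; apply: eq_bigr => l _; rewrite mxE.
  by rewrite !mxE (negbTE xu) (negbTE yu) qhermE.
by rewrite big1 // => u /eqP e; case/negP: iN; rewrite -e imset_f.
Qed.

Lemma sum_hdet_psubmx : (0 < r)%N ->
  \sum_(b : {ffun 'I_r -> 'I_n} | incr_seq b) hdet (psubmx G b) =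
  qreal (minorsum G r).
Proof.
move=> r0; rewrite /minorsum -sum_incr_seq rmorph_sum; apply: eq_bigr => b hb.
exact: hdet_psubmx.
Qed.

Lemma rdet_psubmx_rowrep (w : 'rV[H]_n) i (b : {ffun 'I_r -> 'I_n}) k :
  rdet (psubmx (rowrep G i w) b) k =
  qconj (cdet (psubmx (colrep G i (qadj w)) b) k).
Proof.
rewrite -rdet_qadj; congr rdet; apply/matrixP=> x y; rewrite !mxE.
by case: ifP => _; rewrite ?qconjK ?qhermE.
Qed.

End Assembly.

(* For beta in J_{r,n}{i}, the column of the submatrix coming from column i
   of N is the (unique) k : 'I_r with beta k = i; the inner sum over such k
   thus selects cdet_i of the submatrix (and is empty when i \notin beta). *)
Theorem theorem4p1 (R : realType) (m n r : nat)
    (A : 'M[quat R]_(m, n)) (Ap : 'M[quat R]_(n, m)) :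
  qrank_is A r -> (1 <= r)%N -> is_MP_inverse A Ap ->
  (forall (i : 'I_n) (j : 'I_m),
     Ap i j =
     (\sum_(b : {ffun 'I_r -> 'I_n} | incr_seq b)
        \sum_(k : 'I_r | b k == i)
          cdet (psubmx (colrep (qadj A *m A) i (col j (qadj A))) b) k)
     * qinv (\sum_(b : {ffun 'I_r -> 'I_n} | incr_seq b)
               hdet (psubmx (qadj A *m A) b)))
  /\
  (forall (i : 'I_n) (j : 'I_m),
     Ap i j =
     (\sum_(a : {ffun 'I_r -> 'I_m} | incr_seq a)
        \sum_(k : 'I_r | a k == j)
          rdet (psubmx (rowrep (A *m qadj A) j (row i (qadj A))) a) k)
     * qinv (\sum_(a : {ffun 'I_r -> 'I_m} | incr_seq a)
               hdet (psubmx (A *m qadj A) a))).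
Proof.
move=> hr r0 hAp.
have d_neq0 : minorsum (qadj A *m A) r != 0.
  by rewrite gt_eqF ?minorsum_rank_gt0.
have [cofE minorE] := minorsum_cofsum_gramC A r.
have ApE i j : Ap i j =
    (cofsum (qadj A *m A) r *m qadj A) i j *
    qreal (minorsum (qadj A *m A) r)^-1.
  rewrite -(MP_inverse_cofsum hr hAp) mul_scalar_mx mxE qrealC -mulrA -rmorphM.
  by rewrite divff // rmorph1 mulr1.
split=> i j; rewrite sum_hdet_psubmx ?qinv_real //.
- by rewrite sum_cdet_psubmx //; apply: qherm_gram.
- exact: qherm_gram.
- rewrite -minorE ApE cofE; congr (_ * _).
  have adjA : qadj (row i (qadj A)) = col i A.
    by apply/matrixP=> k l; rewrite !mxE qconjK.
  (* N'_r is Hermitian, so A* N'_r is the conjugate transpose of N'_r A, whose entries are sums of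
     column determinants; conjugation turns these into row determinants. *)
  transitivity (qconj ((cofsum (A *m qadj A) r *m A) j i)).
    by rewrite -qadjE qadjM qherm_cofsum //; apply: qherm_gramr.
  rewrite -sum_cdet_psubmx; last exact: qherm_gramr.
  rewrite raddf_sum; apply: eq_bigr => a _.
  rewrite raddf_sum; apply: eq_bigr => k _.
  by rewrite rdet_psubmx_rowrep ?adjA //; apply: qherm_gramr.
- exact: qherm_gramr.
Qed.
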